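(* Let $H$ be a Hadamard matrix of order $n$ with rows $r_1,\dots,r_n$, let $C_i=r_i^\top r_i$ ($1\le i\le n$) and $C_0=O_n$. Let $\ell$ be an odd integer with $1<\ell<n-1$, and suppose that $\sum_{i=1}^\ell C_i=\ell I_n+aA+b(J_n-A-I_n)$ for integers $a\neq b$ and a symmetric $(0,1)$-matrix $A$ with zero diagonal, and that $C_iJ_n=O_n$ for $i=1,\dots,\ell$. Let $L=(L_{i,j})_{i,j=1}^{\ell+1}$ be a symmetric Latin square of order $\ell+1$ on the symbol set $\{0,1,\dots,\ell\}$ with all diagonal entries equal to $0$, and let $\bar L=(\epsilon_{i,j}C_{L_{i,j}})_{i,j=1}^{\ell+1}$ (a block matrix), where $\epsilon_{i,j}=1$ if $i\le j$ and $\epsilon_{i,j}=-1$ if $i>j$. Define $A_0=I_{(\ell+1)n}$, $A_1=I_{\ell+1}\otimes A$, $A_2=I_{\ell+1}\otimes(J_n-A-I_n)$, and let $A_3,A_4$ be the $(0,1)$-matrices with disjoint supports such that $\bar L=A_3-A_4$. Then $\{A_0,A_1,A_2,A_3,A_4\}$ is a non-symmetric association scheme with $4$ classes.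
   Context: A Hadamard matrix of order $n$ is an $n\times n$ $\{1,-1\}$-matrix $H$ with $HH^\top=nI_n$; $J_n$ is the all-ones and $O_n$ the zero matrix. A $d$-class commutative association scheme on a finite set $X$ is a set of nonzero $(0,1)$-matrices $A_0,\dots,A_d$ indexed by $X$ with $A_0=I$, $\sum_i A_i=J$, each $A_i^\top\in\{A_0,\dots,A_d\}$ (with $A_i^\top\ne A_0$ for $i\ge1$), $A_iA_j=\sum_k p_{i,j}^kA_k$ for nonnegative integers $p_{i,j}^k$, and $A_iA_j=A_jA_i$; it is symmetric if all $A_i$ are symmetric, non-symmetric otherwise. *)

(* Defs.v *)
From mathcomp Require Export all_boot all_order all_algebra.
From mathcomp Require Export mxtens.

Set Implicit Arguments.
Unset Strict Implicit.
Unset Printing Implicit Defensive.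

Import GRing.Theory.
Local Open Scope ring_scope.

Definition allones (n : nat) : 'M[int]_n := const_mx 1.

Definition hadamard (n : nat) (H : 'M[int]_n) : Prop :=
  (forall i j, H i j = 1 \/ H i j = -1) /\ H *m H^T = n%:R%:M.

Definition mx01 (m n : nat) (A : 'M[int]_(m, n)) : Prop :=
  forall i j, A i j = 0 \/ A i j = 1.

Definition disjoint_supports (m n : nat) (A B : 'M[int]_(m, n)) : Prop :=
  forall i j, ~ (A i j <> 0 /\ B i j <> 0).

(* The rows of H are numbered from 1: for 1 <= k <= n the value is r_k^T r_k
   with r_k = row (k - 1) H; Cmat H 0 is the zero matrix, and so is the junk
   value at k > n. *)
Definition Cmat (n : nat) (H : 'M[int]_n) (k : nat) : 'M[int]_n :=
  if k is k'.+1 then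
    oapp (fun i : 'I_n => (row i H)^T *m row i H) 0 (insub k')
  else 0.

Definition latin_square (m : nat) (L : 'M['I_m]_m) : Prop :=
  (forall i s, exists! j, L i j = s) /\ (forall j s, exists! i, L i j = s).

(* Position ((i, p), (j, q)) of the block matrix, i.e. entry (p, q) of block
   (i, j), sits at the indices used by the Kronecker product *t of mxtens. *)
Definition Lbar (n l : nat) (H : 'M[int]_n) (L : 'M['I_l.+1]_l.+1) :
    'M[int]_(l.+1 * n) :=
  \matrix_(u, v)
    let: (i, p) := mxtens_unindex u in
    let: (j, q) := mxtens_unindex v in
    (if (i <= j)%N then 1 else -1) * Cmat H (L i j) p q.

(* A d-class commutative association scheme on 'I_N, given by the family of
   its adjacency matrices. *)
Record comm_assoc_scheme (N d : nat) (A : 'I_d.+1 -> 'M[int]_N) : Prop := {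
  as_nonzero : forall i, A i <> 0;
  as_mx01 : forall i, mx01 (A i);
  as_id : A ord0 = 1%:M;
  as_sum : \sum_i A i = allones N;
  as_trmx : forall i, exists j, (A i)^T = A j;
  as_trmx_neq0 : forall i, i <> ord0 -> (A i)^T <> A ord0;
  as_mul : exists p : 'I_d.+1 -> 'I_d.+1 -> 'I_d.+1 -> nat,
    forall i j, A i *m A j = \sum_k (p i j k)%:R *: A k;
  as_comm : forall i j, A i *m A j = A j *m A i
}.

Definition symmetric_family (N d : nat) (A : 'I_d.+1 -> 'M[int]_N) : Prop :=
  forall i, (A i)^T = A i.

Definition nonsymmetric_assoc_scheme (N d : nat)
    (A : 'I_d.+1 -> 'M[int]_N) : Prop :=
  comm_assoc_scheme A /\ ~ symmetric_family A.

(* Main.v *)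
(** The rational span of A_0, ..., A_4 is also spanned by I, T = I (x) S,
    Q = I (x) J_n, M = (J - I) (x) J_n = A_3 + A_4 and Lbar = A_3 - A_4, where
    S = C_1 + ... + C_l.  From C_i C_j = n delta_ij C_i and C_i J = 0 one gets
    T^2 = n T, T Q = T M = Q Lbar = M Lbar = 0 and T Lbar = n Lbar.  Writing
    Lbar = sum_k W_k (x) C_k, the W_k are skew-symmetric signed permutation
    matrices, so W_k^2 = -I and Lbar^2 = -n T.  Hence the span is a commutative
    algebra.  Its elements are constant on the classes, so the structure
    constants are entries of products of nonnegative integer matrices. *)
Require Import Defs.
From mathcomp Require Import all_boot all_order all_algebra.
From mathcomp Require Import mxtens.
From mathcomp Require Import ring zify.

Set Implicit Arguments.
Unset Strict Implicit.
Unset Printing Implicit Defensive.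

Import Order.TTheory GRing.Theory Num.Theory.
Local Open Scope ring_scope.

(** * Kronecker products and the all-ones matrix *)

Lemma tensmxDl (m n p q : nat) (A B : 'M[int]_(m, n)) (C : 'M[int]_(p, q)) :
  (A + B) *t C = A *t C + B *t C.
Proof. by apply/matrixP=> i j; rewrite !mxE mulrDl. Qed.

Lemma tensmxDr (m n p q : nat) (A : 'M[int]_(m, n)) (B C : 'M[int]_(p, q)) :
  A *t (B + C) = A *t B + A *t C.
Proof. by apply/matrixP=> i j; rewrite !mxE mulrDr. Qed.

Lemma tensmxZl (m n p q : nat) c (A : 'M[int]_(m, n)) (B : 'M[int]_(p, q)) :
  (c *: A) *t B = c *: (A *t B).
Proof. by apply/matrixP=> i j; rewrite !mxE mulrA. Qed.

Lemma tensmxZr (m n p q : nat) c (A : 'M[int]_(m, n)) (B : 'M[int]_(p, q)) :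
  A *t (c *: B) = c *: (A *t B).
Proof. by apply/matrixP=> i j; rewrite !mxE mulrCA. Qed.

Lemma tensmx_sumr (m n p q : nat) (I : finType) (A : 'M[int]_(m, n))
    (B : I -> 'M[int]_(p, q)) :
  A *t (\sum_i B i) = \sum_i A *t B i.
Proof.
apply: (big_morph (fun X => A *t X)); first exact: tensmxDr.
exact: tensmx0.
Qed.

Lemma tensmx11 (m n : nat) : (1%:M : 'M[int]_m) *t (1%:M : 'M[int]_n) = 1%:M.
Proof.
apply/matrixP=> u v.
case: (mxtens_indexP u)=> i p; case: (mxtens_indexP v)=> j q.
rewrite tensmxE !mxE (can_eq (@mxtens_indexK m n)) xpair_eqE.
by case: (i == j); case: (p == q).
Qed.

Lemma tens_allones (m n : nat) : allones m *t allones n = allones (m * n).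
Proof. by apply/matrixP=> i j; rewrite !mxE mulr1. Qed.

Lemma allones_sqr (n : nat) : allones n *m allones n = n%:R *: allones n.
Proof.
apply/matrixP=> i j; rewrite !mxE.
rewrite (eq_bigr (fun=> 1)); last by move=> k _; rewrite !mxE mulr1.
by rewrite sumr_const card_ord mulr1.
Qed.

Lemma trmx_allones (n : nat) : (allones n)^T = allones n.
Proof. exact: trmx_const. Qed.

(** * Pure submodules, class-constant matrices and intersection numbers *)

(* "Pure": closed under dividing by a nonzero integer, so that products known
   only up to a common denominator can be handled over int. *)
Definition pure_submodule (N : nat) (P : 'M[int]_N -> Prop) : Prop :=
  [/\ forall X Y, P X -> P Y -> P (X + Y),
      forall c X, P X -> P (c *: X) &
      forall c X, c <> 0 -> P (c *: X) -> P X].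

(* For the classes of a scheme this is membership in the rational span of the
   F k, stated without coefficients: those are the entries of X. *)
Definition class_const (N d : nat) (F : 'I_d.+1 -> 'M[int]_N)
    (X : 'M[int]_N) : Prop :=
  forall k u v u' v', F k u v = 1 -> F k u' v' = 1 -> X u v = X u' v'.

Lemma class_const_pure (N d : nat) (F : 'I_d.+1 -> 'M[int]_N) :
  pure_submodule (class_const F).
Proof.
split=> [X Y hX hY|c X hX|c X c0 hX] k u v u' v' hu hv.
- by rewrite !mxE (hX _ _ _ _ _ hu hv) (hY _ _ _ _ _ hu hv).
- by rewrite !mxE (hX _ _ _ _ _ hu hv).
- have := hX _ _ _ _ _ hu hv; rewrite !mxE; apply: mulfI; exact/eqP.
Qed.

(** Commutation is bundled with closure so that a single extension argument from spanning elements
    to the classes yields both axioms. *)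
Definition commuting_product (N : nat) (P : 'M[int]_N -> Prop)
    (X Y : 'M[int]_N) : Prop := X *m Y = Y *m X /\ P (X *m Y).

Lemma commuting_product_sym (N : nat) (P : 'M[int]_N -> Prop) X Y :
  commuting_product P X Y -> commuting_product P Y X.
Proof. by case=> e h; split; rewrite -?e. Qed.

Lemma commuting_product_pure (N : nat) (P : 'M[int]_N -> Prop) Y :
  pure_submodule P -> pure_submodule (commuting_product P ^~ Y).
Proof.
case=> PD PZ PK; split=> [X X' [e h] [e' h']|c X [e h]|c X c0 [e h]].
- by split; rewrite mulmxDl ?mulmxDr ?e ?e' //; apply: PD; rewrite -?e -?e'.
- by split; rewrite -scalemxAl -?scalemxAr ?e //; apply: PZ; rewrite -e.
- split; last by apply: (PK c); rewrite // scalemxAl.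
  apply/matrixP=> i j; apply: (mulfI (introN eqP c0)).
  by move/matrixP: e => /(_ i j); rewrite -scalemxAl -scalemxAr !mxE.
Qed.

(** At each position the entries are 0 or 1 and sum to 1: some entry is 1, and the others, being
    nonnegative with sum 0, vanish. *)
Lemma class_partition (N d : nat) (F : 'I_d.+1 -> 'M[int]_N) :
  (forall i, mx01 (F i)) -> \sum_i F i = allones N ->
  forall u v, exists k0, forall k, F k u v = (k == k0)%:R.
Proof.
move=> F01 Fsum u v.
have sum1 : \sum_k F k u v = 1.
  by move/matrixP: Fsum => /(_ u v); rewrite summxE mxE.
have [/existsP[k0 /eqP hk0]|] := boolP [exists k, F k u v == 1]; last first.
  rewrite negb_exists => /forallP h; exfalso; move: sum1.
  by rewrite big1 // => k _; case: (F01 k u v) => // e; move: (h k); rewrite e.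
exists k0 => k; case: eqVneq => [-> //|kk0].
have /eqP : \sum_(k | k != k0) F k u v = 0.
  move: sum1; rewrite (bigD1 k0) //= hk0 => /eqP.
  by rewrite -subr_eq0 addrAC subrr add0r => /eqP.
rewrite psumr_eq0 => [/allP/(_ k)|i _]; last by case: (F01 i u v) => ->.
by rewrite mem_index_enum kk0 => /(_ isT)/eqP.
Qed.

Lemma class_const_adjacency (N d : nat) (F : 'I_d.+1 -> 'M[int]_N) :
  (forall i, mx01 (F i)) -> \sum_i F i = allones N ->
  forall i, class_const F (F i).
Proof.
move=> F01 Fsum i k u v u' v'.
have [k0 h0] := class_partition F01 Fsum u v.
have [k1 h1] := class_partition F01 Fsum u' v'.
by rewrite !h0 !h1; case: eqVneq => // <- _; case: eqVneq => // <- _.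
Qed.

Lemma mx01_neq0 (m n : nat) (A : 'M[int]_(m, n)) :
  mx01 A -> A <> 0 -> exists u, A u.1 u.2 = 1.
Proof.
move=> A01 A0; have [/existsP[u /eqP hu]|] := boolP [exists u, A u.1 u.2 == 1].
  by exists u.
rewrite negb_exists => /forallP h; case: A0; apply/matrixP=> i j; rewrite mxE.
by case: (A01 i j) => // e; move: (h (i, j)); rewrite e.
Qed.

Lemma mx01_ge0 (m n : nat) (A : 'M[int]_(m, n)) :
  mx01 A -> forall i j, 0 <= A i j.
Proof. by move=> A01 i j; case: (A01 i j) => ->. Qed.

(** Each [p i j k] is read off from [F i *m F j] at a chosen position [r k] of class [k].
    Class-constancy makes the choice irrelevant, and nonnegativity of the product makes the absolute
    value harmless. *)
Lemma intersection_numbers (N d : nat) (F : 'I_d.+1 -> 'M[int]_N) :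
  (forall i, F i <> 0) -> (forall i, mx01 (F i)) -> \sum_i F i = allones N ->
  (forall i j, class_const F (F i *m F j)) ->
  exists p : 'I_d.+1 -> 'I_d.+1 -> 'I_d.+1 -> nat,
    forall i j, F i *m F j = \sum_k (p i j k)%:R *: F k.
Proof.
move=> F0 F01 Fsum FM.
have [r hr] := fin_all_exists (fun k => mx01_neq0 (F01 k) (F0 k)).
exists (fun i j k => `|(F i *m F j) (r k).1 (r k).2|%N) => i j.
apply/matrixP=> u v; rewrite summxE.
have [k0 h0] := class_partition F01 Fsum u v.
rewrite (bigD1 k0) //= big1 => [|k /negPf kk0]; last first.
  by rewrite !mxE h0 kk0 mulr0.
have e1 : F k0 u v = 1 by rewrite h0 eqxx.
rewrite addr0 [RHS]mxE e1 mulr1 (FM i j _ _ _ _ _ e1 (hr k0)) natz gez0_abs //.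
by rewrite mxE sumr_ge0 // => k _; rewrite mulr_ge0 ?mx01_ge0.
Qed.

(** * The rank-one matrices C_k *)

Lemma CmatP (n : nat) (H : 'M[int]_n) (k : nat) :
  Cmat H k = 0 \/ exists2 i : 'I_n, k = i.+1 & Cmat H k = (row i H)^T *m row i H.
Proof.
case: k => [|k] /=; first by left.
by case: insubP => [i _ <-|_] /=; [right; exists i | left].
Qed.

Lemma Cmat_tr (n : nat) (H : 'M[int]_n) (k : nat) : (Cmat H k)^T = Cmat H k.
Proof. by case: (CmatP H k) => [->|[i _ ->]]; rewrite ?trmx0 // trmx_mul trmxK. Qed.

(** The inner factor r_j r_k^T is an entry of H H^T, hence n or 0. For indices outside 1..n both
    sides are zero, so no range condition arises. *)
Lemma Cmat_mul (n : nat) (H : 'M[int]_n) (j k : nat) : hadamard H ->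
  Cmat H j *m Cmat H k = (n%:R *+ (j == k)) *: Cmat H k.
Proof.
case=> _ HH.
have rows i i' : (row i H)^T *m row i H *m ((row i' H)^T *m row i' H) =
    (n%:R *+ (i == i')) *: ((row i H)^T *m row i' H).
  rewrite mulmxA -[_ *m _ *m (row i' H)^T]mulmxA.
  suff -> : row i H *m (row i' H)^T = (n%:R *+ (i == i'))%:M.
    by rewrite mul_mx_scalar -scalemxAl.
  apply/matrixP=> x y; rewrite !ord1 !mxE mulr1n.
  have /matrixP/(_ i i') := HH; rewrite !mxE => <-.
  by apply: eq_bigr => h _; rewrite !mxE.
have [->|] := eqVneq j k; case: (CmatP H k) => [->|[i' -> ->]];
  rewrite ?mulmx0 ?scaler0 //; first by rewrite rows eqxx.
case: (CmatP H j) => [->|[i -> ->]]; first by rewrite mul0mx scale0r.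
by rewrite eqSS val_eqE => /negPf ii'; rewrite rows ii' !scale0r.
Qed.

Lemma Cmat_entry (n : nat) (H : 'M[int]_n) (k : nat) : hadamard H ->
  (0 < k <= n)%N -> forall p q, Cmat H k p q = 1 \/ Cmat H k p q = -1.
Proof.
case=> H1 _; case: k => //= k kn p q; rewrite insubT //=.
rewrite !mxE big_ord1 !mxE.
by case: (H1 (Sub k kn) p) => ->; case: (H1 (Sub k kn) q) => ->;
  [left|right|right|left].
Qed.

(** * Signed layers of the Latin square and the block matrix *)

(** These are the W_k of the overview. The layer of symbol 0 is not skew, but it is always paired
    with C_0 = 0. *)
Definition signed_layer (m : nat) (L : 'M['I_m]_m) (k : 'I_m) : 'M[int]_m :=
  \matrix_(i, j) ((if (i <= j)%N then 1 else -1) * (L i j == k)%:R).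

Lemma Lbar_tens (n l : nat) (H : 'M[int]_n) (L : 'M['I_l.+1]_l.+1) :
  Lbar H L = \sum_k signed_layer L k *t Cmat H k.
Proof.
apply/matrixP=> u v.
case: (mxtens_indexP u)=> i p; case: (mxtens_indexP v)=> j q.
rewrite summxE mxE !mxtens_indexK (bigD1 (L i j)) //= big1 => [|k kL].
  by rewrite tensmxE mxE eqxx mulr1 addr0.
by rewrite tensmxE mxE eq_sym (negPf kL) mulr0 mul0r.
Qed.

(** The support is symmetric because L is, the sign flips across the diagonal, and the diagonal
    carries only the symbol 0. *)
Lemma signed_layer_tr (l : nat) (L : 'M['I_l.+1]_l.+1) (k : 'I_l.+1) :
  L^T = L -> (forall i, L i i = ord0) -> k != ord0 ->
  (signed_layer L k)^T = - signed_layer L k.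
Proof.
move=> Lsym L0 k0; apply/matrixP=> i j; rewrite !mxE.
have -> : L j i = L i j by rewrite -[in LHS]Lsym mxE.
case: (ltngtP i j) => [ij|ij|/val_inj ->]; rewrite ?mulN1r ?mul1r ?opprK //.
by rewrite L0 eq_sym (negPf k0) oppr0.
Qed.

(** The positions of a symbol k <> 0 form a fixed-point-free involution, and the signs at (i, m) and
    (m, i) are opposite. *)
Lemma signed_layer_sqr (l : nat) (L : 'M['I_l.+1]_l.+1) (k : 'I_l.+1) :
  latin_square L -> L^T = L -> (forall i, L i i = ord0) -> k != ord0 ->
  signed_layer L k *m signed_layer L k = - 1%:M.
Proof.
move=> [Lrow Lcol] Lsym L0 k0.
apply/matrixP=> i j; rewrite !mxE.
(* [m] is the partner of [i] under the involution; only the term at [m] survives in the sum. *)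
have [m [Lm m_uniq]] := Lrow i k.
have [i' [Li' i'_uniq]] := Lcol m k.
rewrite (bigD1 m) //= big1 => [|h hm].
  have sw : L m j = L j m by rewrite -[in LHS]Lsym mxE.
  rewrite addr0 !mxE Lm eqxx mulr1 sw; case: (eqVneq i j) => [<-|ij].
    rewrite Lm eqxx mulr1.
    case: (ltngtP i m) => [im|im|/val_inj im]; rewrite ?mulr1 ?mul1r //.
    by move: k0; rewrite -Lm im L0 eqxx.
  case: eqVneq => [/i'_uniq ej|_]; last by rewrite !mulr0 oppr0.
  by move: ij; rewrite -ej (i'_uniq _ Lm) eqxx.
rewrite !mxE; case: eqVneq => [/m_uniq e|_]; last by rewrite mulr0 mul0r.
by rewrite e eqxx in hm.
Qed.

Lemma Lbar_tr (n l : nat) (H : 'M[int]_n) (L : 'M['I_l.+1]_l.+1) :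
  L^T = L -> (forall i, L i i = ord0) -> (Lbar H L)^T = - Lbar H L.
Proof.
move=> Lsym L0; rewrite Lbar_tens -sumrN linear_sum /=.
apply: eq_bigr => k _; rewrite trmx_tens Cmat_tr.
have [->|k0] := eqVneq k ord0; first by rewrite /= !tensmx0 oppr0.
by rewrite signed_layer_tr // -scaleN1r tensmxZl scaleN1r.
Qed.

Lemma Lbar_sqr (n l : nat) (H : 'M[int]_n) (L : 'M['I_l.+1]_l.+1) :
  hadamard H -> latin_square L -> L^T = L -> (forall i, L i i = ord0) ->
  Lbar H L *m Lbar H L = - (n%:R *: (1%:M *t \sum_(k < l.+1) Cmat H k)).
Proof.
move=> hH hL Lsym L0; rewrite Lbar_tens tensmx_sumr scaler_sumr -sumrN.
rewrite mulmx_suml; apply: eq_bigr => k _; rewrite mulmx_sumr (bigD1 k) //=.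
rewrite big1 => [|j /negPf jk]; last first.
  by rewrite tensmx_mul Cmat_mul // val_eqE eq_sym jk scale0r tensmx0.
rewrite addr0 tensmx_mul Cmat_mul // eqxx tensmxZr.
have [->|k0] := eqVneq k ord0; first by rewrite /= !tensmx0 scaler0 oppr0.
by rewrite signed_layer_sqr // -scaleN1r tensmxZl -scalerN scaleN1r.
Qed.

(** Meant for Y = S with c = n and for Y = J with c = 0. *)
Lemma Lbar_mul_tens1 (n l : nat) (H : 'M[int]_n) (L : 'M['I_l.+1]_l.+1)
    (c : int) (Y : 'M[int]_n) :
  (forall k : 'I_l.+1, Cmat H k *m Y = c *: Cmat H k) ->
  Lbar H L *m (1%:M *t Y) = c *: Lbar H L.
Proof.
move=> hY; rewrite Lbar_tens mulmx_suml scaler_sumr; apply: eq_bigr => k _.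
by rewrite tensmx_mul mulmx1 hY tensmxZr.
Qed.

Lemma tens1_mul_Lbar (n l : nat) (H : 'M[int]_n) (L : 'M['I_l.+1]_l.+1)
    (c : int) (Y : 'M[int]_n) :
  (forall k : 'I_l.+1, Y *m Cmat H k = c *: Cmat H k) ->
  (1%:M *t Y) *m Lbar H L = c *: Lbar H L.
Proof.
move=> hY; rewrite Lbar_tens mulmx_sumr scaler_sumr; apply: eq_bigr => k _.
by rewrite tensmx_mul mul1mx hY tensmxZr.
Qed.

Lemma Cmat_mul_sum (n l : nat) (H : 'M[int]_n) : hadamard H ->
  forall k : 'I_l.+1, Cmat H k *m (\sum_(j < l.+1) Cmat H j) = n%:R *: Cmat H k.
Proof.
move=> hH k; rewrite mulmx_sumr (bigD1 k) //= big1 => [|j jk].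
  by rewrite addr0 Cmat_mul // eqxx.
by rewrite Cmat_mul // val_eqE eq_sym (negPf jk) scale0r.
Qed.

Lemma sum_Cmat_mul (n l : nat) (H : 'M[int]_n) : hadamard H ->
  forall k : 'I_l.+1, (\sum_(j < l.+1) Cmat H j) *m Cmat H k = n%:R *: Cmat H k.
Proof.
move=> hH k; apply: trmx_inj.
rewrite trmx_mul linear_sum linearZ /= Cmat_tr -(Cmat_mul_sum hH).
by congr (_ *m _); apply: eq_bigr => j _; rewrite Cmat_tr.
Qed.

(** Row i already has its symbol 0 on the diagonal. *)
Lemma latin_offdiag_gt0 (l : nat) (L : 'M['I_l.+1]_l.+1) (i j : 'I_l.+1) :
  latin_square L -> (forall i, L i i = ord0) -> i != j -> (0 < L i j)%N.
Proof.
move=> [Lrow _] L0 ij; rewrite lt0n; apply: contraNneq ij => Lij.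
have [m [_ m_uniq]] := Lrow i ord0.
by rewrite -(m_uniq i (L0 i)) -(m_uniq j) //; apply: val_inj.
Qed.

(** By disjointness, A_3 + A_4 is the entrywise absolute value of [Lbar], whose off-diagonal blocks
    have entries 1 and -1 and whose diagonal blocks are C_0 = 0. *)
Lemma Lbar_support (n l : nat) (H : 'M[int]_n) (L : 'M['I_l.+1]_l.+1)
    (A3 A4 : 'M[int]_(l.+1 * n)) :
  hadamard H -> (l <= n)%N -> latin_square L -> (forall i, L i i = ord0) ->
  mx01 A3 -> mx01 A4 -> disjoint_supports A3 A4 -> Lbar H L = A3 - A4 ->
  A3 + A4 = (allones l.+1 - 1%:M) *t allones n.
Proof.
move=> hH ln hL L0 A3_01 A4_01 disj e; apply/matrixP=> u v.
have -> : (A3 + A4) u v = `|Lbar H L u v|.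
  rewrite e !mxE; have := disj u v.
  by case: (A3_01 u v) => ->; case: (A4_01 u v) => -> // [].
case: (mxtens_indexP u)=> i p; case: (mxtens_indexP v)=> j q {e}.
rewrite tensmxE !mxE !mxtens_indexK.
case: (eqVneq i j) => [<-|ij]; first by rewrite L0 /= mxE mulr0.
have Lij : (0 < L i j <= n)%N.
  by rewrite (latin_offdiag_gt0 hL L0 ij) (leq_trans _ ln) // -ltnS.
by case: (Cmat_entry hH Lij p q) => ->; case: ifP.
Qed.

(* Rules out A = 0 and A = J - I: the row sum l + c (n - 1) cannot vanish, as
   0 < l < n - 1. *)
Lemma scalar_plus_offdiag_mul_allones_neq0 (n l : nat) (c : int) :
  (0 < l)%N -> (l < n - 1)%N ->
  (l%:R *: 1%:M + c *: (allones n - 1%:M)) *m allones n <> 0.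
Proof.
move=> l0 ln; have n0 : (0 < n)%N by lia.
rewrite mulmxDl -!scalemxAl mulmxBl allones_sqr mul1mx.
move=> /matrixP/(_ (Ordinal n0) (Ordinal n0)); rewrite !mxE !mulr1 => e.
have {e} : (l%:Z + c * (n%:Z - 1) = 0) by rewrite -e !natz.
have : l%:Z < n%:Z - 1 by lia.
have : 0 < l%:Z by lia.
move: l%:Z (n%:Z - 1) => x y x0 xy e.
(* For c < 0 integrality gives c <= -1, so c y <= -y < -x. *)
by have [c0|c0] := lerP 0 c; nia.
Qed.

(** * Verification of the scheme axioms *)

Theorem theorem5p7 (n l : nat) (H A : 'M[int]_n) (a b : int)
    (L : 'M['I_l.+1]_l.+1) (A3 A4 : 'M[int]_(l.+1 * n))
    (hH : hadamard H)
    (l_odd : odd l) (l_gt1 : (1 < l)%N) (l_ltn : (l < n - 1)%N)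
    (a_neq_b : a <> b)
    (A_sym : A^T = A) (A_01 : mx01 A) (A_diag : forall i, A i i = 0)
    (hsum : \sum_(1 <= i < l.+1) Cmat H i =
            l%:R *: 1%:M + a *: A + b *: (allones n - A - 1%:M))
    (hCJ : forall i : nat, (1 <= i <= l)%N -> Cmat H i *m allones n = 0)
    (hL : latin_square L) (L_sym : L^T = L) (L_diag : forall i, L i i = ord0)
    (A3_01 : mx01 A3) (A4_01 : mx01 A4) (A34_disj : disjoint_supports A3 A4)
    (hLbar : Lbar H L = A3 - A4) :
  nonsymmetric_assoc_scheme (d := 4) (fun i : 'I_5 =>
    [:: 1%:M;
        1%:M *t A;
        1%:M *t (allones n - A - 1%:M);
        A3;
        A4]`_i).
Proof.
pose J := allones n; pose B := J - A - 1%:M.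
pose S := \sum_(k < l.+1) Cmat H k.
pose T : 'M[int]_(l.+1 * n) := 1%:M *t S.
pose Q : 'M[int]_(l.+1 * n) := 1%:M *t J.
pose M := (allones l.+1 - 1%:M) *t J.
set F := (fun i : 'I_5 => _).
have n_gt0 : (0 < n)%N by lia.
(* [S] also includes the index 0, which contributes C_0 = 0. *)
have Sdef : S = l%:R *: 1%:M + a *: A + b *: B.
  by rewrite -hsum /S -(big_mkord xpredT (Cmat H)) big_ltn //= add0r.
have CJ (k : 'I_l.+1) : Cmat H k *m J = 0 *: Cmat H k.
  rewrite scale0r; case: k => [[|k] hk] /=; first by rewrite mul0mx.
  by apply: (hCJ k.+1).
have JC (k : 'I_l.+1) : J *m Cmat H k = 0 *: Cmat H k.
  by apply: trmx_inj; rewrite trmx_mul linearZ /= Cmat_tr trmx_allones CJ.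
have SJ : S *m J = 0.
  by rewrite mulmx_suml big1 // => k _; rewrite CJ scale0r.
have JS : J *m S = 0.
  by rewrite mulmx_sumr big1 // => k _; rewrite JC scale0r.
have JJ : J *m J = n%:R *: J by exact: allones_sqr.
have B_01 : mx01 B.
  move=> i j; rewrite !mxE; have [<-|ij] := eqVneq i j.
    by left; rewrite A_diag.
  by case: (A_01 i j) => ->; [right | left].
have A_neq0 : A <> 0.
  move=> A0; apply: (@scalar_plus_offdiag_mul_allones_neq0 n l b) => //; first by lia.
  by rewrite -SJ Sdef /B A0 scaler0 addr0 subr0.
have B_neq0 : B <> 0.
  move=> B0; apply: (@scalar_plus_offdiag_mul_allones_neq0 n l a) => //; first by lia.
  rewrite -SJ Sdef B0 scaler0 addr0; congr ((_ + _ *: _) *m _).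
  by apply/eqP; rewrite -subr_eq0 addrAC; apply/eqP.
have tens1_neq0 (X : 'M[int]_n) : X <> 0 -> (1%:M : 'M_l.+1) *t X <> 0.
  move=> X0 e; apply: X0; apply/matrixP=> i j; rewrite [RHS]mxE.
  move/matrixP: e => /(_ (mxtens_index (ord0, i)) (mxtens_index (ord0, j))).
  by rewrite tensmxE !mxE eqxx mul1r.
have tens1_01 (X : 'M[int]_n) : mx01 X -> mx01 ((1%:M : 'M_l.+1) *t X).
  move=> X01 u v; case: (mxtens_indexP u)=> i p; case: (mxtens_indexP v)=> j q.
  by rewrite tensmxE mxE; case: eqP; rewrite ?mul0r ?mul1r; [|left].
have A34 : A3 + A4 = M.
  by apply: (Lbar_support hH _ hL L_diag) => //; lia.
have M_tr : M^T = M.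
  by rewrite /M trmx_tens linearB /= !trmx_allones trmx1.
(* Since M is symmetric and [Lbar] is skew, transposing 2 A_3 = M + Lbar gives M - Lbar = 2 A_4. *)
have A3_tr : A3^T = A4.
  have two : 2%:R *: A3 = M + Lbar H L.
    by rewrite -A34 hLbar; apply/matrixP=> i j; rewrite !mxE; ring.
  have e : 2%:R *: A3^T = 2%:R *: A4.
    rewrite -linearZ /= two linearD /= M_tr Lbar_tr // -A34 hLbar.
    by apply/matrixP=> i j; rewrite !mxE; ring.
  apply/matrixP=> i j; move/matrixP: e => /(_ i j).
  by rewrite !mxE; apply: mulfI.
have A4_tr : A4^T = A3 by rewrite -A3_tr trmxK.
(* Otherwise A_4 = A_3^T = 0 too and M = 0, but the corner block (0, l) of M is J because l > 0. *)
have A3_neq0 : A3 <> 0.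
  move=> A30; move: A34; rewrite -A3_tr A30 trmx0 addr0.
  pose i0 : 'I_n := Ordinal n_gt0.
  move=> /matrixP/(_ (mxtens_index (ord0, i0)) (mxtens_index (ord_max, i0))).
  by rewrite tensmxE !mxE -val_eqE /=; case: (l) l_gt1.
have A4_neq0 : A4 <> 0 by move=> A40; apply: A3_neq0; rewrite -A4_tr A40 trmx0.
have F0 i : F i <> 0.
  case: i => [[|[|[|[|[|]]]]]] //= hi; rewrite /F /=;
    try exact: tens1_neq0; try by [].
  rewrite -tensmx11; apply: tens1_neq0.
  by move=> /matrixP/(_ (Ordinal n_gt0) (Ordinal n_gt0)); rewrite !mxE eqxx.
have id01 m : mx01 (1%:M : 'M[int]_m).
  by move=> i j; rewrite mxE; case: eqP; [right | left].
have F01 i : mx01 (F i).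
  by case: i => [[|[|[|[|[|]]]]]] //= hi; rewrite /F //=; exact: tens1_01.
have Qdef : 1%:M + 1%:M *t A + 1%:M *t B = Q.
  rewrite -tensmx11 -!tensmxDr; congr (_ *t _).
  by apply/matrixP=> i j; rewrite !mxE; ring.
have Fsum : \sum_i F i = allones (l.+1 * n).
  rewrite !big_ord_recl big_ord0 /F /= -/J -/B addr0 !addrA Qdef.
  by rewrite -addrA A34 -tensmxDl addrC subrK tens_allones.
have FCC := class_const_adjacency F01 Fsum.
have [PD PZ _] := class_const_pure F.
have Tdef : T = l%:R *: 1%:M + a *: (1%:M *t A) + b *: (1%:M *t B).
  by rewrite /T Sdef 2!tensmxDr !tensmxZr tensmx11.
have P1 : class_const F 1%:M := FCC ord0.
have PA : class_const F (1%:M *t A) := FCC (@Ordinal 5 1 isT).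
have PB : class_const F (1%:M *t B) := FCC (@Ordinal 5 2 isT).
have P3 : class_const F A3 := FCC (@Ordinal 5 3 isT).
have P4 : class_const F A4 := FCC (@Ordinal 5 4 isT).
have PT : class_const F T by rewrite Tdef; apply: (PD); [apply: (PD)|]; apply: (PZ).
have PQ : class_const F Q by rewrite -Qdef; apply: (PD) => //; apply: (PD).
have PM : class_const F M by rewrite -A34; apply: (PD).
have PL : class_const F (Lbar H L).
  by rewrite hLbar -scaleN1r; apply: (PD) => //; apply: (PZ).
have P0 : class_const F 0 by rewrite -[0](scale0r 1%:M); apply: (PZ).
(* Passing from the five spanning matrices to the classes needs only the denominators a - b and 2,
   which purity cancels. *)
have ext (P : 'M[int]_(l.+1 * n) -> Prop) : pure_submodule P ->
    P 1%:M -> P T -> P Q -> P M -> P (Lbar H L) -> forall i, P (F i).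
  case=> RD RZ RK R1 RT RQ RM RL.
  have RB X Y : P X -> P Y -> P (X - Y).
    by move=> hX hY; rewrite -scaleN1r; apply: (RD) => //; apply: (RZ).
  have RA : P (1%:M *t A).
    apply: (RK (a - b)); first by move/eqP; rewrite subr_eq0 => /eqP.
    (* This is [Tdef] with I (x) B replaced by Q - I - I (x) A. *)
    suff -> : (a - b) *: (1%:M *t A) = T - (l%:R - b) *: 1%:M - b *: Q.
      by apply: (RB); [apply: (RB) => //|]; apply: (RZ).
    by rewrite Tdef -Qdef; apply/matrixP=> i j; rewrite !mxE; ring.
  case=> [[|[|[|[|[|]]]]]] //= hi; rewrite /F //=.
  - suff -> : 1%:M *t (allones n - A - 1%:M) = Q - 1%:M - 1%:M *t A.
      by apply: (RB) => //; apply: (RB).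
    by rewrite -Qdef; apply/matrixP=> i j; rewrite !mxE; ring.
  - apply: (RK 2%:R) => //.
    suff -> : 2%:R *: A3 = M + Lbar H L by apply: (RD).
    by rewrite -A34 hLbar; apply/matrixP=> i j; rewrite !mxE; ring.
  - apply: (RK 2%:R) => //.
    suff -> : 2%:R *: A4 = M - Lbar H L by apply: (RB).
    by rewrite -A34 hLbar; apply/matrixP=> i j; rewrite !mxE; ring.
pose R := commuting_product (class_const F).
have Rsym X Y : R X Y -> R Y X by exact: commuting_product_sym.
have R1 X : class_const F X -> R 1%:M X.
  by move=> hX; split; rewrite mul1mx ?mulmx1.
have TQ : T *m Q = 0 by rewrite tensmx_mul SJ tensmx0.
have QT : Q *m T = 0 by rewrite tensmx_mul JS tensmx0.
have TM : T *m M = 0 by rewrite tensmx_mul SJ tensmx0.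
have MT : M *m T = 0 by rewrite tensmx_mul JS tensmx0.
have QM : Q *m M = n%:R *: M by rewrite tensmx_mul JJ mul1mx tensmxZr.
have MQ : M *m Q = n%:R *: M by rewrite tensmx_mul JJ mulmx1 tensmxZr.
have QQ : Q *m Q = n%:R *: Q by rewrite tensmx_mul JJ mul1mx tensmxZr.
have TL : T *m Lbar H L = n%:R *: Lbar H L.
  by apply: tens1_mul_Lbar; exact: sum_Cmat_mul.
have LT : Lbar H L *m T = n%:R *: Lbar H L.
  by apply: Lbar_mul_tens1; exact: Cmat_mul_sum.
have QL : Q *m Lbar H L = 0 by rewrite (tens1_mul_Lbar _ JC) scale0r.
have LQ : Lbar H L *m Q = 0 by rewrite (Lbar_mul_tens1 _ CJ) scale0r.
(* M factors through Q, which is placed on the side facing [Lbar]. *)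
have ML : M *m Lbar H L = 0.
  by rewrite /M tensmx_decr -mulmxA QL mulmx0.
have LM : Lbar H L *m M = 0.
  by rewrite /M tensmx_decl mulmxA LQ mul0mx.
have SS : S *m S = n%:R *: S.
  by rewrite mulmx_suml scaler_sumr; apply: eq_bigr => k _; exact: Cmat_mul_sum.
have TT : T *m T = n%:R *: T by rewrite tensmx_mul SS mul1mx tensmxZr.
(* For J of order l + 1, (J - I)^2 = (l - 1)(J - I) + l I. *)
have MM : M *m M = n%:R *: ((l%:R - 1) *: M + l%:R *: Q).
  rewrite tensmx_mul JJ -!tensmxZl -tensmxDl tensmxZr; congr (_ *: (_ *t _)).
  rewrite mulmxBl mulmxBr mul1mx mulmx1 allones_sqr.
  by apply/matrixP=> i j; rewrite !mxE -natr1; ring.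
have LL : Lbar H L *m Lbar H L = (- n%:R) *: T.
  by rewrite Lbar_sqr // scaleNr.
(* The extension is applied to one factor, then, after swapping, to the other; what remains are the
   25 products of spanning matrices. *)
have RF : forall i j, R (F i) (F j).
  have pureR Y : pure_submodule (R^~ Y).
    exact/commuting_product_pure/class_const_pure.
  have Rext Y : R 1%:M Y -> R T Y -> R Q Y -> R M Y -> R (Lbar H L) Y ->
      forall k, R (F k) Y by exact: ext (pureR Y).
  move=> i j; apply: (Rext); apply: (Rsym); apply: (Rext);
    try by [apply: (R1) | apply: (Rsym); apply: (R1)];
    split; rewrite ?(TQ, QT, TM, MT, QM, MQ, QQ, TL, LT) //;
    rewrite ?(QL, LQ, ML, LM, TT, MM, LL) //; do ?[apply: (PZ) | apply: (PD)];
    by [].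
split; first split=> //.
- case=> [[|[|[|[|[|]]]]]] //= hi.
  + by exists ord0; rewrite /F /= trmx1.
  + by exists (@Ordinal 5 1 isT); rewrite /F /= trmx_tens trmx1 A_sym.
  + exists (@Ordinal 5 2 isT); rewrite /F /= trmx_tens !linearB /= !trmx1.
    by rewrite A_sym trmx_allones.
  + by exists (@Ordinal 5 4 isT).
  + by exists (@Ordinal 5 3 isT).
(* If A_i^T = I, a transposed position of the identity lies in class i and in class 0, against the
   partition. *)
- move=> i i0 e; have [u hu] := mx01_neq0 (F01 ord0) (F0 ord0).
  have [k hk] := class_partition F01 Fsum u.2 u.1.
  have hi : F i u.2 u.1 = 1 by rewrite -hu -e mxE.
  have h0 : F ord0 u.2 u.1 = 1 by move: hu; rewrite /F /= !mxE eq_sym.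
  move: hi h0; rewrite !hk; case: eqVneq => // ik _; case: eqVneq => // k0 _.
  by apply: i0; rewrite ik k0.
- by apply: intersection_numbers => // i j; case: (RF i j).
- by move=> i j; case: (RF i j).
(* Symmetry would force A_3 = A_4, impossible for nonzero matrices with disjoint supports. *)
move=> /(_ (@Ordinal 5 3 isT)); rewrite /F /= A3_tr => A43.
have [u hu] := mx01_neq0 A3_01 A3_neq0.
by apply: (A34_disj u.1 u.2); rewrite A43 hu.
Qed.
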